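(* There is an absolute constant $C$ such that for every Boolean function $f:\{0,1\}^n\times\{0,1\}^n\to\{0,1\}$, $$Q^{ent}(f)\ge \tfrac14\log_2\!\big(1/\gamma(f)\big)-C.$$
   Context: $Q^{ent}(f)$ is the minimal number of qubits communicated in an arbitrary (multi-round) two-party quantum protocol between Alice (holding $x$) and Bob (holding $y$) that computes $f(x,y)$ with error probability at most $1/3$ on every input, where the parties may share an arbitrary prior entangled state of unlimited size not counted in the cost. An assignment of real unit vectors $\alpha_x,\beta_y$ (any dimension) is a realization of $f$ with margin $\gamma>0$ if $\langle\alpha_x,\beta_y\rangle\ge\gamma$ whenever $f(x,y)=0$ and $\langle\alpha_x,\beta_y\rangle\le-\gamma$ whenever $f(x,y)=1$; $\gamma(f)$ denotes the supremum of margins over all realizations of $f$. *)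

(* Defs.v *)
From HB Require Import structures.
From mathcomp Require Import all_boot all_order all_algebra.
From mathcomp Require Import boolp classical_sets reals exp.
From mathcomp.real_closed Require Import complex.

Set Implicit Arguments.
Unset Strict Implicit.
Unset Printing Implicit Defensive.

Import Order.TTheory GRing.Theory Num.Theory.
Local Open Scope ring_scope.

Definition bits (n : nat) := {ffun 'I_n -> bool}.

Definition boolfun (n : nat) := bits n -> bits n -> bool.

Definition qbasis (N : nat) := {ffun 'I_N -> bool}.

(** A (not necessarily unitary) linear operator, given by its matrix
    entries <s|U|t> in the computational basis. *)
Definition qop (R : realType) (N : nat) := qbasis N -> qbasis N -> R[i].

Definition qvec (R : realType) (N : nat) := qbasis N -> R[i].

Definition qapply (R : realType) (N : nat) (U : qop R N) (v : qvec R N)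
  : qvec R N := fun s => \sum_(t : qbasis N) U s t * v t.

Definition qunitary (R : realType) (N : nat) (U : qop R N) : Prop :=
  forall s s' : qbasis N,
    \sum_(t : qbasis N) conjc (U t s) * U t s' = (s == s')%:R.

(** U acts only on the qubits in S, i.e. U = u (x) Id_{complement of S}. *)
Definition acts_on (R : realType) (N : nat) (S : {set 'I_N}) (U : qop R N)
  : Prop :=
  (forall s s' : qbasis N,
      (exists i, i \notin S /\ s i != s' i) -> U s s' = 0) /\
  (forall s s' t t' : qbasis N,
      (forall i, i \in S -> s i = t i /\ s' i = t' i) ->
      (forall i, i \notin S -> s i = s' i /\ t i = t' i) ->
      U s s' = U t t').

Definition sqmod (R : realType) (z : R[i]) : R :=
  complex.Re z ^+ 2 + complex.Im z ^+ 2.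

Definition qnorm2 (R : realType) (N : nat) (v : qvec R N) : R :=
  \sum_(s : qbasis N) sqmod (v s).

(** The global system consists of [nq] qubits.  Initially Alice holds the
    qubits in [ownA0] and Bob the others; the global initial state [init]
    is arbitrary (it is the shared entangled state together with any
    private workspace) and does not depend on the inputs.
    Round [k] is described by [nth _ rounds k = (a, T)]: the sender is
    Alice if [a] and Bob otherwise; the sender first applies the unitary
    [rU k z] (z = the sender's input) acting on the qubits she/he currently
    holds, and then sends the qubits of [T] (which she/he holds) to the
    other party; this costs #|T| qubits of communication.
    At the end, the output party (Alice if [outA], else Bob) applies the
    unitary [fU z] on his/her qubits and measures the qubit [outq] (which
    he/she holds) in the computational basis; the result is the output. *)
Record protocol (R : realType) (n : nat) := Protocol {
  nq : nat;
  init : qvec R nq;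
  ownA0 : {set 'I_nq};
  rounds : seq (bool * {set 'I_nq});
  rU : nat -> bits n -> qop R nq;
  outA : bool;
  fU : bits n -> qop R nq;
  outq : 'I_nq
}.
Arguments nq {R n} p.
Arguments init {R n} p _.
Arguments ownA0 {R n} p.
Arguments rounds {R n} p.
Arguments rU {R n} p _ _ _ _.
Arguments outA {R n} p.
Arguments fU {R n} p _ _ _.
Arguments outq {R n} p.

Section ProtocolDefs.
Variables (R : realType) (n : nat) (P : protocol R n).

Definition ownA (k : nat) : {set 'I_(nq P)} :=
  foldl (fun (A : {set 'I_(nq P)}) (r : bool * {set 'I_(nq P)}) =>
           if r.1 then A :\: r.2 else A :|: r.2)
        (ownA0 P) (take k (rounds P)).

Definition owned (b : bool) (k : nat) : {set 'I_(nq P)} :=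
  if b then ownA k else ~: ownA k.

Definition nrounds := size (rounds P).

Definition round_sender (k : nat) : bool := (nth (true, finset.set0) (rounds P) k).1.
Definition round_sent (k : nat) : {set 'I_(nq P)} :=
  (nth (true, finset.set0) (rounds P) k).2.

Definition valid_protocol : Prop :=
  qnorm2 (init P) = 1 /\
  (forall k, (k < nrounds)%N ->
     round_sent k \subset owned (round_sender k) k /\
     forall z : bits n,
       qunitary (rU P k z) /\ acts_on (owned (round_sender k) k) (rU P k z)) /\
  (forall z : bits n,
     qunitary (fU P z) /\ acts_on (owned (outA P) nrounds) (fU P z)) /\
  outq P \in owned (outA P) nrounds.

Fixpoint state_after (x y : bits n) (k : nat) : qvec R (nq P) :=
  match k with
  | O => init P
  | k'.+1 => qapply (rU P k' (if round_sender k' then x else y))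
                    (state_after x y k')
  end.

Definition final_state (x y : bits n) : qvec R (nq P) :=
  qapply (fU P (if outA P then x else y)) (state_after x y nrounds).

Definition prob_output (x y : bits n) (b : bool) : R :=
  \sum_(s : qbasis (nq P) | s (outq P) == b) sqmod (final_state x y s).

Definition qcost : nat := \sum_(r <- rounds P) #|r.2|.

Definition computes (f : boolfun n) : Prop :=
  valid_protocol /\
  forall x y : bits n, prob_output x y (f x y) >= 2%:R / 3%:R.

End ProtocolDefs.

Definition dotR (R : realType) (d : nat) (a b : 'I_d -> R) : R :=
  \sum_(i < d) a i * b i.

Definition realization (R : realType) (n : nat) (f : boolfun n) (d : nat)
    (alpha beta : bits n -> 'I_d -> R) (g : R) : Prop :=
  (forall x, dotR (alpha x) (alpha x) = 1) /\
  (forall y, dotR (beta y) (beta y) = 1) /\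
  (forall x y, if f x y then dotR (alpha x) (beta y) <= - g
               else g <= dotR (alpha x) (beta y)).

Definition margin (R : realType) (n : nat) (f : boolfun n) : R :=
  sup [set g : R | 0 < g /\
        exists d (alpha beta : bits n -> 'I_d -> R), realization f alpha beta g]%classic.

Definition log2 (R : realType) (x : R) : R := ln x / ln 2%:R.
Arguments margin {R n} f.

(* Main.v *)
Require Import Defs.
From HB Require Import structures.
From mathcomp Require Import all_boot all_order all_algebra.
From mathcomp Require Import boolp classical_sets reals exp.
From mathcomp.real_closed Require Import complex.
From mathcomp Require Import fintype finset ring lra.

Set Implicit Arguments.
Unset Strict Implicit.
Unset Printing Implicit Defensive.

Import Order.TTheory GRing.Theory Num.Theory.
Local Open Scope ring_scope.

(** Heisenberg picture: the observable measured at the end is propagated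
    backwards through the protocol and kept in the form
    [\sum_i A_i(x) B_i(y)], where [A_i(x)] and [B_i(y)] are contractions acting
    on the qubits that Alice, respectively Bob, holds at that time.  A local
    unitary only conjugates the [A_i] or the [B_i].  A transmitted qubit is
    transferred from one family to the other by expanding in the four matrix
    units |t><t'| of that qubit, so communicating [c] qubits yields [4 ^ c] terms.
    On the shared initial state the bias of the output is therefore
    [\sum_i <A_i(x)^* init, B_i(y) init>], an inner product of a vector depending
    on [x] and one depending on [y], both of squared norm at most [4 ^ c].
    Normalizing gives a realization of margin [1 / (3 * 4 ^ c)], hence even
    log2 (1 / margin) <= 2 c + log2 3. *)

Local Notation Re := complex.Re.
Local Notation Im := complex.Im.

(** * Matrices, adjoints and inner products on [N] qubits *)

Section Operators.
Variables (R : realType) (N : nat).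
Implicit Types (S T : {set 'I_N}) (A B U : qop R N).
Implicit Types (u v w : qvec R N) (s t : qbasis N).

Definition qdot u v : R[i] := \sum_s conjc (u s) * v s.

Definition qmul A B : qop R N := fun s s' => \sum_t A s t * B t s'.

Definition qadj A : qop R N := fun s s' => conjc (A s' s).

Definition qid : qop R N := fun s s' => (s == s')%:R.

Definition qsum (I : finType) (J : {set I}) (F : I -> qop R N) : qop R N :=
  fun s s' => \sum_(i in J) F i s s'.

Lemma Re_sum (I : finType) (P : pred I) (F : I -> R[i]) :
  Re (\sum_(i | P i) F i) = \sum_(i | P i) Re (F i).
Proof. by apply: (big_morph (@complex.Re R)) => // -[a b] [c d]. Qed.

Lemma sqmodE (z : R[i]) : sqmod z = Re (conjc z * z).
Proof. by case: z => a b; rewrite /sqmod /=; ring. Qed.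

Lemma sqmod_ge0 (z : R[i]) : 0 <= sqmod z.
Proof. by rewrite addr_ge0 ?sqr_ge0. Qed.

Lemma qdot_norm v : Re (qdot v v) = qnorm2 v.
Proof. by rewrite Re_sum; apply: eq_bigr => s _; rewrite sqmodE. Qed.

Lemma qdotC u v : qdot v u = conjc (qdot u v).
Proof.
rewrite /qdot rmorph_sum; apply: eq_bigr => s _.
by rewrite rmorphM /= conjcK mulrC.
Qed.

Lemma Re_qdotC u v : Re (qdot v u) = Re (qdot u v).
Proof. by rewrite qdotC; case: (qdot u v). Qed.

Lemma qapply_mul A B v : qapply (qmul A B) v = qapply A (qapply B v).
Proof.
apply/funext => s; rewrite /qapply /qmul.
under eq_bigr do rewrite mulr_suml.
rewrite exchange_big /=; apply: eq_bigr => t _.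
by rewrite mulr_sumr; apply: eq_bigr => r _; rewrite mulrA.
Qed.

Lemma qapply_adj A u v : qdot u (qapply A v) = qdot (qapply (qadj A) u) v.
Proof.
rewrite /qdot /qapply /qadj.
under eq_bigr do rewrite mulr_sumr.
rewrite exchange_big /=; apply: eq_bigr => t _.
rewrite rmorph_sum mulr_suml; apply: eq_bigr => s _.
by rewrite rmorphM /= conjcK; ring.
Qed.

Lemma qadjK A : qadj (qadj A) = A.
Proof. by apply/funext => s; apply/funext => t; rewrite /qadj conjcK. Qed.

Lemma qmulA A B U : qmul A (qmul B U) = qmul (qmul A B) U.
Proof.
apply/funext => s; apply/funext => s'; rewrite /qmul.
under eq_bigr do rewrite mulr_sumr.
rewrite exchange_big /=; apply: eq_bigr => t _.
by rewrite mulr_suml; apply: eq_bigr => r _; rewrite mulrA.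
Qed.

Lemma qmul1 A : qmul A qid = A.
Proof.
apply/funext => s; apply/funext => t; rewrite /qmul (bigD1 t) //= big1.
  by rewrite /qid eqxx mulr1 addr0.
by move=> r /negbTE rt; rewrite /qid rt mulr0.
Qed.

Lemma qapply1 v : qapply qid v = v.
Proof.
apply/funext => s; rewrite /qapply (bigD1 s) //= big1.
  by rewrite /qid eqxx mul1r addr0.
by move=> r /negbTE rt; rewrite /qid eq_sym rt mul0r.
Qed.

Lemma qmul_suml (I : finType) (J : {set I}) (F : I -> qop R N) B :
  qmul (qsum J F) B = qsum J (fun i => qmul (F i) B).
Proof.
apply/funext => s; apply/funext => t; rewrite /qmul /qsum.
by under eq_bigr do rewrite mulr_suml; rewrite exchange_big.
Qed.

Lemma qmul_sumr (I : finType) (J : {set I}) (F : I -> qop R N) B :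
  qmul B (qsum J F) = qsum J (fun i => qmul B (F i)).
Proof.
apply/funext => s; apply/funext => t; rewrite /qmul /qsum.
by under eq_bigr do rewrite mulr_sumr; rewrite exchange_big.
Qed.

Lemma qapply_sum (I : finType) (J : {set I}) (F : I -> qop R N) v :
  qapply (qsum J F) v = fun s => \sum_(i in J) qapply (F i) v s.
Proof.
apply/funext => s; rewrite /qapply /qsum.
by under eq_bigr do rewrite mulr_suml; rewrite exchange_big.
Qed.

Lemma qdot_sumr (I : finType) (J : {set I}) u (F : I -> qvec R N) :
  qdot u (fun s => \sum_(i in J) F i s) = \sum_(i in J) qdot u (F i).
Proof.
by rewrite /qdot; under eq_bigr do rewrite mulr_sumr; rewrite exchange_big.
Qed.

Lemma qunitary_mul U : qunitary U -> qmul (qadj U) U = qid.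
Proof. by move=> uU; apply/funext => s; apply/funext => t; apply: uU. Qed.

Lemma qunitary_dot U u v :
  qunitary U -> qdot (qapply U u) (qapply U v) = qdot u v.
Proof.
by move=> uU; rewrite qapply_adj -qapply_mul qunitary_mul // qapply1.
Qed.

Lemma qunitary_norm U v : qunitary U -> qnorm2 (qapply U v) = qnorm2 v.
Proof. by move=> uU; rewrite -!qdot_norm qunitary_dot. Qed.

(** * Contractions *)

(** Equivalent to operator norm at most 1; this symmetric form is visibly
    invariant under adjunction. *)
Definition contr A := forall u v,
  Re (qdot u (qapply A v)) *+ 2 <= qnorm2 u + qnorm2 v.

(** Coordinatewise expansion of |u - v|^2 >= 0. *)
Lemma qdot_le u v : Re (qdot u v) *+ 2 <= qnorm2 u + qnorm2 v.
Proof.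
rewrite Re_sum -sumrMnl -big_split; apply: ler_sum => s _ /=.
case: (u s) (v s) => a b [c d]; rewrite /sqmod /=.
by have := sqr_ge0 (a - c); have := sqr_ge0 (b - d); nra.
Qed.

(** The choice [u = A v] in the symmetric form leaves 2|Av|^2 <= |Av|^2 + |v|^2. *)
Lemma contr_norm A v : contr A -> qnorm2 (qapply A v) <= qnorm2 v.
Proof. by move/(_ (qapply A v) v); rewrite qdot_norm; lra. Qed.

Lemma norm_contr A : (forall v, qnorm2 (qapply A v) <= qnorm2 v) -> contr A.
Proof.
by move=> hA u v; have := qdot_le u (qapply A v); have := hA v; lra.
Qed.

Lemma contr_mul A B : contr A -> contr B -> contr (qmul A B).
Proof.
move=> cA cB; apply: norm_contr => v; rewrite qapply_mul.
exact: le_trans (contr_norm _ cA) (contr_norm v cB).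
Qed.

Lemma contr_adj A : contr A -> contr (qadj A).
Proof.
by move=> cA u v; rewrite qapply_adj qadjK Re_qdotC addrC; apply: cA.
Qed.

Lemma contr_unitary U : qunitary U -> contr U.
Proof. by move=> uU; apply: norm_contr => v; rewrite qunitary_norm. Qed.

Lemma contr_id : contr qid.
Proof. by apply: norm_contr => v; rewrite qapply1. Qed.

(** * Partial bit strings and operators local to a set of qubits *)

(** A partial string on [T] is stored at full length, with zeros elsewhere, so that strings are
    split and glued by addition alone. *)
Definition restr T s : qbasis N := [ffun i => (i \in T) && s i].

Lemma restrE T s i : restr T s i = (i \in T) && s i.
Proof. by rewrite ffunE. Qed.

(* The group law of bit strings, and hence also its subtraction, is bitwise
   exclusive or. *)
Lemma qbasisD s t i : (s + t) i = s i (+) t i.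
Proof. by rewrite ffunE. Qed.

Lemma qbasisB s t i : (s - t) i = s i (+) t i.
Proof. by rewrite !ffunE. Qed.

Lemma qbasis0 i : (0 : qbasis N) i = false.
Proof. by rewrite ffunE. Qed.

Lemma restrD T s t : restr T (s + t) = restr T s + restr T t.
Proof. by apply/ffunP => i; rewrite qbasisD !restrE qbasisD; case: (_ \in _). Qed.

Lemma restrB T s t : restr T (s - t) = restr T s - restr T t.
Proof. by apply/ffunP => i; rewrite qbasisB !restrE qbasisB; case: (_ \in _). Qed.

Lemma restrK T s : restr T (restr T s) = restr T s.
Proof. by apply/ffunP => i; rewrite !restrE; case: (_ \in _). Qed.

Lemma restr_sub S T s : S \subset T -> restr S (restr T s) = restr S s.
Proof.
move=> /subsetP ST; apply/ffunP => i; rewrite !restrE.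
by case: (boolP (i \in S)) => // /ST ->.
Qed.

Lemma restr_eqP T s t :
  reflect (forall i, i \in T -> s i = t i) (restr T s == restr T t).
Proof.
apply: (iffP eqP) => [e i iT|h].
  by move/ffunP: e => /(_ i); rewrite !restrE iT.
by apply/ffunP => i; rewrite !restrE; case: (boolP (i \in T)) => // /h ->.
Qed.

(** For matrices supported on pairs agreeing outside [S], the second clause of
    [acts_on S] amounts to invariance under bit flips outside [S]. *)
Definition local S A : Prop :=
  (forall s s', restr (~: S) s != restr (~: S) s' -> A s s' = 0) /\
  (forall s s' z, restr S z = 0 -> A (s + z) (s' + z) = A s s').

Lemma local_acts_on S A : acts_on S A -> local S A.
Proof.
move=> [h1 h2]; split=> [s s' ne|s s' z z0].
  apply: h1; apply: contrapT => h; move/negP: ne; apply; apply/restr_eqP => i.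
  rewrite inE => iS; apply: contrapT => /eqP ne; apply: h; by exists i.
have zS i : i \in S -> z i = false.
  by move=> iS; move/ffunP: z0 => /(_ i); rewrite restrE iS qbasis0.
case: (boolP (restr (~: S) s == restr (~: S) s')) => [/restr_eqP e|].
  apply: h2 => i iS; first by rewrite !qbasisD zS // !addbF.
  by rewrite !qbasisD e // inE.
(* Strings that differ outside [S] still do so after the flip, so both entries vanish. *)
move=> ne; rewrite [RHS]h1.
  apply: h1; apply: contrapT => h; move/negP: ne; apply; apply/restr_eqP => i.
  rewrite inE => iS; apply: contrapT => /eqP ne; apply: h; exists i; split=> //.
  by rewrite !qbasisD; apply: contraNneq ne => /addIb ->.
apply: contrapT => h; move/negP: ne; apply; apply/restr_eqP => i.
rewrite inE => iS; apply: contrapT => /eqP ne; apply: h; by exists i.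
Qed.

Lemma local_mul S A B : local S A -> local S B -> local S (qmul A B).
Proof.
move=> [a1 a2] [b1 b2]; split=> [s s' ne|s s' z z0].
  rewrite /qmul big1 // => t _.
  case: (eqVneq (restr (~: S) s) (restr (~: S) t)) => [e|/a1 ->]; last by rewrite mul0r.
  by rewrite b1 ?mulr0 // -e.
rewrite /qmul (reindex_inj (addIr z)).
by apply: eq_bigr => t _; rewrite a2 // b2.
Qed.

Lemma local_adj S A : local S A -> local S (qadj A).
Proof.
move=> [a1 a2]; split=> [s s' ne|s s' z z0]; rewrite /qadj; last by rewrite a2.
by rewrite a1 ?conjc0 // eq_sym.
Qed.

Lemma local_id S : local S qid.
Proof.
split=> [s s' ne|s s' z z0]; rewrite /qid.
  by case: eqVneq => // e; rewrite e eqxx in ne.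
by rewrite (inj_eq (addIr z)).
Qed.

Lemma local_sub S (S' : {set 'I_N}) A : S \subset S' -> local S A -> local S' A.
Proof.
move=> SS' [a1 a2]; split=> [s s' ne|s s' z z0].
  apply: a1; apply: contraNneq ne => e; apply/eqP.
  by rewrite -[LHS](restr_sub (T := ~: S)) ?setCS // e restr_sub // setCS.
by rewrite a2 // -(restr_sub _ SS') z0; apply/ffunP => i; rewrite restrE qbasis0 andbF.
Qed.

(** In [A B] only the intermediate string equal to [s] outside [S] and to [s'] on [S] contributes;
    in [B A] it is the opposite mixture. The involution t -> s + s' - t exchanges the two. *)
Lemma local_comm S A B : local S A -> local (~: S) B -> qmul A B = qmul B A.
Proof.
move=> [a1 a2] [b1 b2]; apply/funext => s; apply/funext => s'.
rewrite /qmul [RHS](reindex_inj (can_inj (subKr (s + s')))).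
apply: eq_bigr => t _; rewrite -addrA.
have eA : s' = t + (s' - t) by rewrite addrC subrK.
have eB : s + (s' - t) = s' + (s - t) by rewrite addrCA.
have e0 : s = t + (s - t) by rewrite addrC subrK.
case: (eqVneq (restr S t) (restr S s')) => [e|ne]; last first.
  rewrite b1 ?setCK // mulr0 b1 ?mul0r // setCK.
  by apply: contraNneq ne; rewrite restrD -{1}[restr S s]addr0 => /addrI /esym /eqP;
    rewrite restrB subr_eq0 => /eqP ->.
case: (eqVneq (restr (~: S) s) (restr (~: S) t)) => [e'|ne]; last first.
  rewrite a1 // mul0r [X in _ * X]a1 ?mulr0 // eB.
  by apply: contraNneq ne; rewrite restrD -{2}[restr _ s']addr0 => /addrI /eqP;
    rewrite restrB subr_eq0 => /eqP ->.
(* Now [s - t] vanishes outside [S] and [s' - t] vanishes on [S], so flip invariance matches the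
   factors. *)
rewrite mulrC; congr (_ * _).
  by rewrite eB {1}e0 b2 // restrB e' subrr.
by rewrite {2}eA a2 // restrB e subrr.
Qed.

(** * Block decomposition along a set of qubits *)

(** The blocks of a matrix relative to the qubits in [T]: [cblk] strips the
    block <t|A|t'> of its [T]-part, and [eblk] is the matrix unit |t><t'|. *)
Definition cblk T t t' A : qop R N := fun s s' =>
  (restr T s == restr T s')%:R * A (s - restr T s + t) (s' - restr T s' + t').

Definition eblk T t t' : qop R N := fun s s' =>
  ((restr T s == t) && (s' == s - t + t'))%:R.

Definition strings T : {set qbasis N} := [set t | restr T t == t].

Lemma stringsP T t : reflect (restr T t = t) (t \in strings T).
Proof. by rewrite inE; apply: eqP. Qed.

Lemma restr_strings T s : restr T s \in strings T.
Proof. by apply/stringsP; rewrite restrK. Qed.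

Lemma card_strings T : #|strings T| = (2 ^ #|T|)%N.
Proof.
rewrite -card_bool -(card_pffun_on false); apply: eq_card => t.
rewrite inE; apply/eqP/pffun_onP => [<-|[h _]].
  split=> [|b //]; apply/subsetP => i.
  by rewrite inE restrE; case: (i \in T).
apply/ffunP => i; rewrite restrE; case: (boolP (i \in T)) => //= iT.
by apply/esym; apply: contraNF iT => ti; apply: (subsetP h); rewrite inE ti.
Qed.

Lemma sum_strings (V : nmodType) T s (F : qbasis N -> V) :
  \sum_(r in strings T) F r *+ (restr T s == r) = F (restr T s).
Proof.
rewrite (bigD1 (restr T s)) ?restr_strings //= eqxx big1 ?addr0 // => r.
by move=> /andP[_ /negbTE]; rewrite eq_sym => ->.
Qed.

Lemma shift_inj (r t : qbasis N) : injective (fun s => s - r + t).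
Proof. exact: inj_comp (addIr t) (addIr (- r)). Qed.

(** This is |t><r| on the qubits of [T], applied to [u]. *)
Definition cut T r t u : qvec R N := fun s =>
  (restr T s == t)%:R * u (s - t + r).

Lemma cut_shift T r t u s : r \in strings T -> t \in strings T ->
  cut T r t u (s - r + t) = (restr T s == r)%:R * u s.
Proof.
move=> /stringsP hr /stringsP ht.
by rewrite /cut restrD restrB hr ht addrK subrK -subr_eq0 addrK subr_eq0.
Qed.

(** Pythagoras: each entry of [u] survives in exactly one cut, the one with [r] its [T]-part. *)
Lemma sum_cut T t u : t \in strings T ->
  \sum_(r in strings T) qnorm2 (cut T r t u) = qnorm2 u.
Proof.
move=> ht; rewrite /qnorm2.
under eq_bigr => r hr.
  rewrite (reindex_inj (@shift_inj r t)) /=.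
  under eq_bigr do rewrite cut_shift //.
  over.
rewrite exchange_big /=; apply: eq_bigr => s _.
rewrite -[RHS](sum_strings T s (fun=> sqmod (u s))); apply: eq_bigr => r _.
by case: (_ == r); rewrite ?mul1r // mul0r /sqmod /= expr0n addr0.
Qed.

(** The stripped block is the sum over [r] of |r><t| A |t'><r|; the outer factors are moved onto the
    vectors. *)
Lemma qdot_cblk T t t' A u v : t \in strings T -> t' \in strings T ->
  qdot u (qapply (cblk T t t' A) v) =
  \sum_(r in strings T) qdot (cut T r t u) (qapply A (cut T r t' v)).
Proof.
move=> ht ht'; rewrite /qdot /qapply; apply/esym.
under eq_bigr => r hr.
  rewrite (reindex_inj (@shift_inj r t)) /=.
  under eq_bigr => s _.
    rewrite cut_shift // (reindex_inj (@shift_inj r t')) /=.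
    under eq_bigr do rewrite cut_shift //.
    over.
  over.
rewrite exchange_big /=; apply: eq_bigr => s _.
rewrite mulr_sumr -[RHS](sum_strings T s (fun r => \sum_s' conjc (u s) *
  ((r == restr T s')%:R * A (s - r + t) (s' - restr T s' + t') * v s'))).
apply: eq_bigr => r _; case: (_ == r) => /=; last first.
  by rewrite mul0r conjc0 mul0r.
rewrite mul1r mulr_sumr; apply: eq_bigr => s' _.
by rewrite [r == _]eq_sym; case: eqVneq => [->|_]; rewrite ?(mul1r, mul0r, mulr0).
Qed.

(** The symmetric form of contractivity is applied to each pair of cuts and summed; the squared
    norms of the cuts add up exactly. *)
Lemma contr_cblk T t t' A : t \in strings T -> t' \in strings T ->
  contr A -> contr (cblk T t t' A).
Proof.
move=> ht ht' cA u v; rewrite qdot_cblk // Re_sum -sumrMnl.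
rewrite -(sum_cut u ht) -(sum_cut v ht') -big_split.
by apply: ler_sum => r _; apply: cA.
Qed.

Lemma contr_eblk T t t' : contr (eblk T t t').
Proof.
apply: norm_contr => v; rewrite /qnorm2 [leRHS](reindex_inj (@shift_inj t t')).
apply: ler_sum => s _; rewrite /qapply (bigD1 (s - t + t')) //= big1.
  rewrite addr0 /eblk eqxx andbT; case: (_ == t); first by rewrite mul1r.
  by rewrite mul0r {1}/sqmod /= expr0n addr0 sqmod_ge0.
by move=> r /negbTE hr; rewrite /eblk hr andbF mul0r.
Qed.

Lemma local_eblk T t t' : t \in strings T -> t' \in strings T ->
  local T (eblk T t t').
Proof.
move=> /stringsP ht /stringsP ht'; split=> [s s' ne|s s' z z0]; rewrite /eblk.
  case: eqP => //= _; case: eqP => //= e; case/negP: ne; rewrite e.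
  apply/restr_eqP => i; rewrite inE => /negbTE iT.
  by rewrite qbasisD qbasisB -ht -ht' !restrE iT /= !addbF.
rewrite restrD z0 addr0; congr (_ && _)%:R.
by rewrite -(inj_eq (addIr z) s') [s - t + t' + z]addrAC [s + z - t]addrAC.
Qed.

Lemma local_cblk S T t t' A : T \subset S ->
  t \in strings T -> t' \in strings T ->
  local S A -> local (S :\: T) (cblk T t t' A).
Proof.
move=> /subsetP TS /stringsP ht /stringsP ht' [a1 a2].
split=> [s s' ne|s s' z /ffunP z0]; rewrite /cblk.
  case: restr_eqP => [e|]; last by rewrite mul0r.
  rewrite mul1r a1 //; apply: contraNneq ne => /eqP/restr_eqP e'.
  apply/restr_eqP => i; rewrite !inE negb_and negbK => /orP[/e //|iS].
  have /negbTE iT : i \notin T by apply: contraNN iS => /TS.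
  have := e' i; rewrite inE iS => /(_ isT).
  by rewrite !(qbasisB, qbasisD) -ht -ht' !restrE iT /= !addbF.
rewrite !restrD (inj_eq (addIr (restr T z))); congr (_ * _).
(* The flip [z] reaches the arguments of [A] only through [z - restr T z], which vanishes on all of
   [S]. *)
have e r q : r + z - (restr T r + restr T z) + q =
    r - restr T r + q + (z - restr T z).
  apply/ffunP => i; rewrite !(qbasisB, qbasisD).
  by case: (r i); case: (q i); case: (z i); case: (restr T r i);
    case: (restr T z i).
rewrite !e; apply: a2; apply/ffunP => i; move/(_ i): z0.
rewrite !(restrE, qbasisB, qbasis0) inE.
by case: (i \in S); case: (i \in T); case: (z i).
Qed.

(** Only the pair made of the [T]-parts of [s] and [s'] contributes to the entry at [s], [s']. *)
Lemma blockE T A : A = qsum (setX (strings T) (strings T))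
  (fun p => qmul (cblk T p.1 p.2 A) (eblk T p.1 p.2)).
Proof.
apply/funext => s; apply/funext => s'; apply/esym; rewrite /qsum.
have hs := restr_strings T s; have hs' := restr_strings T s'.
rewrite (bigD1 (restr T s, restr T s')) ?in_setX ?hs ?hs' //= big1.
  (* The sole intermediate string is [s'] with its [T]-part replaced by that of [s]. *)
  rewrite addr0 /qmul (bigD1 (s' - restr T s' + restr T s)) //= big1.
    rewrite addr0 /cblk /eblk restrD restrB !restrK subrr add0r eqxx mul1r.
    by rewrite addrK !subrK !eqxx mulr1.
  move=> r /negbTE ne; rewrite /eblk.
  rewrite -[s' == _](inj_eq (@shift_inj (restr T s') (restr T s))).
  by rewrite addrK subrK [_ == r]eq_sym ne andbF mulr0.
move=> [t t'] /andP[]; rewrite in_setX /= => /andP[/stringsP ht /stringsP ht'] ne.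
rewrite /qmul big1 // => r _; rewrite /cblk /eblk.
case: eqP => [e|]; last by rewrite !mul0r.
case: eqP => [e2|]; last by rewrite mulr0.
case: eqP => [e3|]; last by rewrite mulr0.
by case/negP: ne; rewrite e e2 e3 restrD restrB e2 ht ht' subrr add0r.
Qed.

(** * Sums of product observables across a cut *)

Definition tame S A := local S A /\ contr A.

Lemma tame_mul S A B : tame S A -> tame S B -> tame S (qmul A B).
Proof. by move=> [? ?] [? ?]; split; [apply: local_mul|apply: contr_mul]. Qed.

Lemma tame_adj S A : tame S A -> tame S (qadj A).
Proof. by move=> [? ?]; split; [apply: local_adj|apply: contr_adj]. Qed.

Lemma tame_id S : tame S qid.
Proof. by split; [apply: local_id|apply: contr_id]. Qed.

Lemma tame_sub S (S' : {set 'I_N}) A : S \subset S' -> tame S A -> tame S' A.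
Proof. by move=> SS' [lA cA]; split=> //; apply: local_sub lA. Qed.

Lemma tame_acts_on S U : acts_on S U -> qunitary U -> tame S U.
Proof. by move=> aU uU; split; [apply: local_acts_on|apply: contr_unitary]. Qed.

(** Bounds the tensor rank of the observable [O x y] across the cut
    [S | ~: S], the input [x] being available on the [S] side only. *)
Definition decomp (X Y : Type) S m (O : X -> Y -> qop R N) :=
  exists (I : finType) (J : {set I}) (A : I -> X -> qop R N) (B : I -> Y -> qop R N),
  [/\ #|J| = m,
      forall i x, i \in J -> tame S (A i x),
      forall i y, i \in J -> tame (~: S) (B i y) &
      forall x y, O x y = qsum J (fun i => qmul (A i x) (B i y))].

(** Factors on complementary sets commute, so either party may be listed first. *)
Lemma decomp_swap (X Y : Type) S m (O : X -> Y -> qop R N) :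
  decomp S m O -> decomp (~: S) m (fun y x => O x y).
Proof.
move=> [I [J [A [B [cJ hA hB hO]]]]]; exists I, J, B, A; split=> //.
  by move=> i x iJ; rewrite setCK; apply: hA.
move=> y x; rewrite hO; apply/funext => s; apply/funext => s'.
apply: eq_bigr => i iJ; congr (_ s s').
by apply: (local_comm (S := S)); [case: (hA i x iJ)|case: (hB i y iJ)].
Qed.

(** [U x] commutes with every [B i y], so the conjugation is absorbed by the [A i x]. *)
Lemma decomp_conj (X Y : Type) S m (O : X -> Y -> qop R N) (U : X -> qop R N) :
  (forall x, tame S (U x)) -> decomp S m O ->
  decomp S m (fun x y => qmul (qadj (U x)) (qmul (O x y) (U x))).
Proof.
move=> tU [I [J [A [B [cJ hA hB hO]]]]].
exists I, J, (fun i x => qmul (qadj (U x)) (qmul (A i x) (U x))), B.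
split=> // [i x iJ|x y].
  by apply: tame_mul; [apply: tame_adj|apply: tame_mul; first exact: hA].
rewrite hO qmul_suml qmul_sumr; apply/funext => s; apply/funext => s'.
apply: eq_bigr => i iJ; congr (_ s s'); rewrite -!qmulA.
congr (qmul _ (qmul _ _)); apply/esym/(local_comm (S := S)).
  by case: (tU x).
by case: (hB i y iJ).
Qed.

(** Each [A i x] is expanded by [blockE]: the stripped block stays, the matrix unit on [T] joins the
    other family. There are (2^|T|)^2 pairs of strings on [T]. *)
Lemma decomp_move (X Y : Type) S T m (O : X -> Y -> qop R N) : T \subset S ->
  decomp S m O -> decomp (S :\: T) (m * 4 ^ #|T|) O.
Proof.
move=> TS [I [J [A [B [cJ hA hB hO]]]]].
exists (I * (qbasis N * qbasis N))%type, (setX J (setX (strings T) (strings T))),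
  (fun p x => cblk T p.2.1 p.2.2 (A p.1 x)),
  (fun p y => qmul (eblk T p.2.1 p.2.2) (B p.1 y)); split.
- by rewrite !cardsX cJ !card_strings -expnMn.
- move=> [i [t t']] x; rewrite !in_setX /= => /and3P[iJ ht ht'].
  have [lA cA] := hA i x iJ.
  by split; [apply: local_cblk|apply: contr_cblk].
- move=> [i [t t']] y; rewrite !in_setX /= => /and3P[iJ ht ht'].
  apply: tame_mul.
    apply: (@tame_sub T); first by rewrite setCD subsetUr.
    by split; [apply: local_eblk|apply: contr_eblk].
  by apply: tame_sub (hB i y iJ); rewrite setCS subsetDl.
- move=> x y; rewrite hO; apply/funext => s; apply/funext => s'.
  rewrite /qsum; under eq_bigr => i _ do
    rewrite {1}(blockE T (A i x)) qmul_suml /qsum.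
  rewrite pair_big_dep; apply: eq_big => [[i p]|[i p] _] /=.
    by rewrite in_setX.
  by rewrite qmulA.
Qed.

End Operators.

(** * Backward propagation through a protocol *)

Section Protocols.
Variables (R : realType) (n : nat).

Lemma decomp_conj_side (N : nat) (X : Type) (S : {set 'I_N}) m
    (O : X -> X -> qop R N) (b : bool) (U : X -> qop R N) :
  (forall z, tame (if b then S else ~: S) (U z)) -> decomp S m O ->
  decomp S m (fun x y => let z := if b then x else y in
                         qmul (qadj (U z)) (qmul (O x y) (U z))).
Proof.
case: b => tU dO; first exact: decomp_conj.
by rewrite -[S]setCK; apply: decomp_swap; apply: decomp_conj => //; apply: decomp_swap.
Qed.

Lemma qdot_conj (N : nat) (O U : qop R N) (v : qvec R N) :
  qdot v (qapply (qmul (qadj U) (qmul O U)) v) =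
  qdot (qapply U v) (qapply O (qapply U v)).
Proof. by rewrite !qapply_mul qapply_adj qadjK. Qed.

(** Output 0 has eigenvalue +1, matching the sign convention of [realization]. *)
Definition pauliZ (N : nat) (q : 'I_N) : qop R N :=
  fun s s' => if s == s' then (-1) ^+ s q else 0.

Lemma qapply_pauliZ (N : nat) (q : 'I_N) (v : qvec R N) s :
  qapply (pauliZ q) v s = (-1) ^+ s q * v s.
Proof.
rewrite /qapply (bigD1 s) //= big1 => [|t /negbTE ne].
  by rewrite /pauliZ eqxx addr0.
by rewrite /pauliZ eq_sym ne mul0r.
Qed.

Lemma tame_pauliZ (N : nat) (S : {set 'I_N}) (q : 'I_N) :
  q \in S -> tame S (pauliZ q).
Proof.
move=> qS; split; last first.
  apply: norm_contr => v; apply: ler_sum => s _; rewrite qapply_pauliZ.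
  case: (s q); last by rewrite mul1r.
  by case: (v s) => a b; rewrite expr1 mulN1r /sqmod /= !sqrrN.
split=> [s s' ne|s s' z z0]; rewrite /pauliZ.
  by case: eqVneq => // e; rewrite e eqxx in ne.
rewrite (inj_eq (addIr z)) qbasisD.
by move/ffunP: z0 => /(_ q); rewrite restrE qbasis0 qS /= => ->; rewrite addbF.
Qed.

Lemma decomp_local (N : nat) (X : Type) (S : {set 'I_N}) (b : bool) (Z : qop R N) :
  tame (if b then S else ~: S) Z -> decomp S 1 (fun _ _ : X => Z).
Proof.
have dec T : tame T Z -> decomp T 1 (fun _ _ : X => Z).
  move=> tZ; exists unit, [set tt], (fun _ _ => Z), (fun _ _ => @qid R N); split=> //.
  - exact: cards1.
  - by move=> *; apply: tame_id.
  - move=> _ _; rewrite qmul1; apply/funext => s; apply/funext => s'.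
    by rewrite /qsum big_set1.
case: b => [/dec //|/dec dZ].
by rewrite -[S]setCK; exact: (decomp_swap dZ).
Qed.

Local Notation state P := (@state_after R n P).
Local Notation final P := (@final_state R n P).

Section Run.
Variables (P : protocol R n) (validP : valid_protocol P).

Lemma ownA_step k : (k < nrounds P)%N -> ownA P k.+1 =
  if round_sender P k then ownA P k :\: round_sent P k
  else ownA P k :|: round_sent P k.
Proof.
move=> kP; rewrite /ownA (take_nth (true, set0) kP) -cats1 foldl_cat /=.
by rewrite -/(round_sender P k) -/(round_sent P k).
Qed.

(** Going back in time, the sent qubits return to the sender. Since the sender held them, this
    restores the ownership before the round exactly. *)
Lemma decomp_round k m (O : bits n -> bits n -> qop R (nq P)) :
  (k < nrounds P)%N -> decomp (ownA P k.+1) m O ->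
  decomp (ownA P k) (m * 4 ^ #|round_sent P k|) O.
Proof.
move=> kP; case: validP => [_ [/(_ k kP) [sub _] _]] dO.
move: dO; rewrite ownA_step //; move: sub; rewrite /owned.
case: (round_sender P k) => sub dO.
  (* When Alice is the sender, the qubits leave Bob's family, so the roles are swapped around the
     move. *)
  have := decomp_move _ (decomp_swap dO) => /(_ (round_sent P k)).
  rewrite setCD subsetUr => /(_ isT).
  rewrite setDUl setDv setU0 -[(_ :\: _)%SET]setCK => /decomp_swap.
  by rewrite setCK setCD setCK; move/setUidPl: sub => ->.
have := decomp_move (subsetUr (ownA P k) (round_sent P k)) dO.
rewrite setDUl setDv setU0; suff -> : ownA P k :\: round_sent P k = ownA P k by [].
by apply/setDidPl; rewrite disjoint_sym disjoints_subset.
Qed.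

(** Induction on the number [d] of remaining rounds. At [k = 0] the state no longer depends on the
    inputs. *)
Lemma decomp_run d k : (k + d)%N = nrounds P ->
  exists2 O : bits n -> bits n -> qop R (nq P),
    decomp (ownA P k) (4 ^ \sum_(k <= i < nrounds P) #|round_sent P i|) O &
    forall x y, qdot (state P x y k) (qapply (O x y) (state P x y k)) =
      qdot (final P x y) (qapply (pauliZ (outq P)) (final P x y)).
Proof.
case: (validP) => _ [hU [hF hq]].
elim: d k => [|d IH] k hk.
  rewrite addn0 in hk; rewrite -hk big_geq // expn0.
  have dZ := decomp_local (bits n) (tame_pauliZ hq).
  have tF z : tame (owned P (outA P) (nrounds P)) (fU P z).
    by have [uF aF] := hF z; apply: tame_acts_on.
  have := decomp_conj_side tF dZ; rewrite hk => dO.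
  by eexists; first exact: dO; move=> x y /=; rewrite qdot_conj.
have kP : (k < nrounds P)%N by rewrite -hk -addSnnS leq_addr.
have [|O dO eO] := IH k.+1; first by rewrite addSnnS.
have tU z : tame (owned P (round_sender P k) k) (rU P k z).
  by have [_ /(_ z) [uU aU]] := hU k kP; apply: tame_acts_on.
(* The sender acts before sending, so backwards the transfer is undone first and the unitary
   second. *)
have := decomp_conj_side tU (decomp_round kP dO).
rewrite [in X in _ -> exists2 O, decomp _ (4 ^ X) O & _]big_ltn // addnC expnD => dO'.
by eexists; first exact: dO'; move=> x y /=; rewrite qdot_conj -eO.
Qed.

Lemma state_norm x y k : (k <= nrounds P)%N -> qnorm2 (state P x y k) = 1.
Proof.
case: validP => n1 [hU _]; elim: k => [//|k IH] kP /=.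
have [_ h] := hU k kP; rewrite qunitary_norm; last exact: (h _).1.
exact: IH (ltnW kP).
Qed.

Lemma final_norm x y : qnorm2 (final P x y) = 1.
Proof.
case: (validP) => _ [_ [hF _]].
by rewrite qunitary_norm ?state_norm //; exact: (hF _).1.
Qed.

Lemma prob_sum x y : prob_output P x y true + prob_output P x y false = 1.
Proof.
rewrite -(final_norm x y) /qnorm2 (bigID (fun s : qbasis (nq P) => s (outq P))) /=.
by congr (_ + _); apply: eq_bigl => s; case: (s _).
Qed.

Lemma prob_bias x y :
  Re (qdot (final P x y) (qapply (pauliZ (outq P)) (final P x y))) =
  prob_output P x y false - prob_output P x y true.
Proof.
set v := final P x y.
rewrite Re_sum (bigID (fun s : qbasis (nq P) => s (outq P))) /= addrC.
rewrite /prob_output -/v -sumrN; congr (_ + _).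
  apply: eq_big => s; first by case: (s _).
  by move=> /negbTE sq; rewrite qapply_pauliZ sq mul1r sqmodE.
apply: eq_big => s; first by case: (s _).
by move=> sq; rewrite qapply_pauliZ sq expr1 mulN1r mulrN sqmodE; case: (conjc _ * _).
Qed.

Lemma qcostE : qcost P = \sum_(0 <= i < nrounds P) #|round_sent P i|.
Proof. by rewrite /qcost (big_nth (true, set0)). Qed.

End Run.

(** * From vectors of bounded norm to the margin *)

Section Margin.
Variable f : boolfun n.

Lemma margin_realization d (alpha beta : bits n -> 'I_d -> R) g :
  0 < g -> realization f alpha beta g -> g <= margin f.
Proof.
move=> g0 rg; apply: ub_le_sup; last by split=> //; exists d, alpha, beta.
(* For [sup] to dominate its members the set must be bounded: by Cauchy-Schwarz at a single input,
   no margin exceeds 1. *)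
exists 1 => h [h0 [e [a [b [ha [hb hf]]]]]].
pose x : bits n := [ffun => false].
(* The sign [c] treats both values of [f x x] at once. *)
have hab (c : R) : c ^+ 2 = 1 -> c * dotR (a x) (b x) <= 1.
  move=> c1; have -> : 1 = (dotR (a x) (a x) + dotR (b x) (b x)) / 2 :> R.
    by rewrite ha hb; field.
  rewrite ler_pdivlMr // -big_split mulrAC mulr_sumr.
  apply: ler_sum => i _ /=.
  have := sqr_ge0 (c * a x i - b x i); rewrite sqrrB exprMn c1; nra.
have := hf x x; case: (f x x).
  have := hab (-1); rewrite sqrrN expr1n => /(_ erefl); lra.
have := hab 1; rewrite expr1n => /(_ erefl); lra.
Qed.

Lemma dotR_enum (T : finType) (a b : T -> R) :
  dotR (fun i : 'I_#|T| => a (enum_val i)) (fun i => b (enum_val i)) =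
  \sum_t a t * b t.
Proof. by rewrite /dotR [RHS](reindex _ (onW_bij _ (@enum_val_bij T))). Qed.

(* Each side is padded with a private coordinate, so that all vectors get
   squared norm exactly [K] without changing the inner products. *)
Lemma margin_ge (I : finType) (a b : bits n -> I -> R) (K e : R) :
  0 < K -> 0 < e ->
  (forall x, \sum_i a x i ^+ 2 <= K) -> (forall y, \sum_i b y i ^+ 2 <= K) ->
  (forall x y, if f x y then \sum_i a x i * b y i <= - e
               else e <= \sum_i a x i * b y i) ->
  e / K <= margin f.
Proof.
move=> K0 e0 ha hb hab.
pose pad (c0 : bool) (c : I -> R) (t : I + bool) : R := (match t with
  | inl i => c i
  | inr c1 => if c0 == c1 then Num.sqrt (K - \sum_i c i ^+ 2) else 0 end)
  / Num.sqrt K.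
have sK : (Num.sqrt K)^-1 * (Num.sqrt K)^-1 = K^-1.
  by rewrite -invfM -expr2 sqr_sqrtr // ltW.
have pad_norm c0 c : \sum_i c i ^+ 2 <= K -> \sum_t pad c0 c t * pad c0 c t = 1.
  move=> hc; under eq_bigr do rewrite mulrACA sK.
  rewrite -mulr_suml big_sumType /= big_bool /=.
  under eq_bigr do rewrite -expr2.
  have e2 : Num.sqrt (K - \sum_i c i ^+ 2) * Num.sqrt (K - \sum_i c i ^+ 2) =
    K - \sum_i c i ^+ 2 by rewrite -expr2 sqr_sqrtr // subr_ge0.
  by case: c0; rewrite /= e2 ?mulr0 ?mul0r ?(addr0, add0r) addrC subrK divff // gt_eqF.
have pad_dot x y : \sum_t pad true (a x) t * pad false (b y) t =
    (\sum_i a x i * b y i) / K.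
  under eq_bigr do rewrite mulrACA sK.
  by rewrite -mulr_suml big_sumType /= big_bool /= mulr0 mul0r !addr0.
apply: (@margin_realization #|{: I + bool}|
  (fun x i => pad true (a x) (enum_val i)) (fun y i => pad false (b y) (enum_val i))).
  exact: divr_gt0.
split; [|split] => [x|y|x y]; rewrite dotR_enum ?pad_norm // pad_dot.
by have := hab x y; case: (f x y); rewrite -?mulNr ler_pM2r ?invr_gt0.
Qed.

Lemma margin_computes (P : protocol R n) :
  computes P f -> (3 * 4 ^+ qcost P)^-1 <= margin f :> R.
Proof.
move=> [validP hf].
have [O dO eO] := decomp_run validP (add0n _).
move: dO; rewrite -qcostE => -[I [J [A [B [cJ hA hB hO]]]]].
set K : R := 4 ^+ qcost P; have cK : #|J|%:R = K by rewrite cJ natrX.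
pose v := init P.
pose part (b : bool) (z : R[i]) : R := if b then Re z else Im z.
(* The vectors [w i] are concatenated and made real by listing real and imaginary parts; indices
   outside [J] get zeros. *)
pose coords (w : I -> qvec R (nq P)) (t : I * (qbasis (nq P) * bool)) :=
  if t.1 \in J then part t.2.2 (w t.1 t.2.1) else 0.
have dot_coords w w' : \sum_t coords w t * coords w' t =
    \sum_(i in J) Re (qdot (w i) (w' i)).
  rewrite -(pair_bigA _ (fun i t => coords w (i, t) * coords w' (i, t))) /=.
  rewrite [RHS]big_mkcond; apply: eq_bigr => i _; rewrite /coords /=.
  case: (i \in J); last by rewrite big1 // => *; rewrite mul0r.
  rewrite -(pair_bigA _ (fun s b => part b (w i s) * part b (w' i s))) /= Re_sum.
  apply: eq_bigr => s _; rewrite big_bool /=.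
  by case: (w i s) (w' i s) => ? ? [? ?] /=; rewrite mulNr opprK.
have norm_coords w : (forall i, i \in J -> qnorm2 (w i) <= 1) ->
    \sum_t coords w t ^+ 2 <= K.
  move=> hw; under eq_bigr do rewrite expr2.
  rewrite dot_coords -cK -sumr_const; apply: ler_sum => i iJ.
  by rewrite qdot_norm; apply: hw.
have v1 : qnorm2 v = 1 by case: validP.
have -> : (3 * K)^-1 = 3^-1 / K by rewrite invfM.
have K0 : 0 < K by rewrite exprn_gt0.
apply: (@margin_ge _ (fun x => coords (fun i => qapply (qadj (A i x)) v))
                     (fun y => coords (fun i => qapply (B i y) v))) => //.
- by rewrite invr_gt0 ltr0n.
- move=> x; apply: norm_coords => i iJ; rewrite -v1.
  by apply/contr_norm/contr_adj; case: (hA i x iJ).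
- move=> y; apply: norm_coords => i iJ; rewrite -v1.
  by apply/contr_norm; case: (hB i y iJ).
move=> x y; rewrite dot_coords.
have -> : \sum_(i in J) Re (qdot (qapply (qadj (A i x)) v) (qapply (B i y) v)) =
    prob_output P x y false - prob_output P x y true.
  rewrite -prob_bias -eO hO qapply_sum qdot_sumr Re_sum /=.
  by apply: eq_bigr => i _; rewrite qapply_mul [in RHS]qapply_adj.
(* The correct output has probability at least 2/3 and the other at most 1/3, so the bias is at
   least 1/3 with the right sign. *)
have := hf x y; have := prob_sum validP x y.
by case: (f x y); lra.
Qed.

End Margin.
End Protocols.

(** * Taking logarithms *)

Theorem mainTheorem8 (R : realType) :
  exists C : R, forall (n : nat) (f : boolfun n) (P : protocol R n),
    computes P f ->
    (qcost P)%:R >= 4%:R^-1 * log2 (margin f)^-1 - C.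
Proof.
(* The factor 3 in the margin bound costs at most [log2 3], whatever [n] and [f]. *)
exists (log2 3) => n f P /margin_computes; set c := qcost P => hm.
have K0 : 0 < 3 * 4 ^+ c :> R by rewrite mulr_gt0 ?exprn_gt0.
(* Positivity makes inversion and [ln] monotone here. *)
have m0 : 0 < margin f :> R by apply: lt_le_trans hm; rewrite invr_gt0.
have l2 : 0 < ln 2 :> R by rewrite ln_gt0 // ltr1n.
have l3 : 0 <= log2 3 :> R by rewrite divr_ge0 ?ltW // ln_gt0 // ltr1n.
suff : log2 (margin f)^-1 <= log2 3 + 2 * c%:R :> R.
  by have : 0 <= c%:R :> R by []; lra.
have -> : log2 3 + 2 * c%:R = log2 (3 * 4 ^+ c) :> R.
  have -> : 4 = 2 ^+ 2 :> R by rewrite -natrX.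
  rewrite /log2 lnM ?posrE ?exprn_gt0 // -exprM lnXn // mulrDl.
  by rewrite -mulr_natr; field; rewrite gt_eqF.
rewrite ler_pM2r ?invr_gt0 // ler_ln ?posrE ?invr_gt0 //.
by rewrite -[leRHS]invrK lef_pV2 ?posrE ?invr_gt0.
Qed.
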